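(* Let $(G,u,v)$ be a rigidly marked twice-marked bridgeless graph of genus $2$ with torsion order $k$. Then $(G,u,v)$ has $k$-general transmission if and only if the class $[u-v]\in\mathrm{Jac}(G)$ is non-recurrent.
   Context: A graph is a finite, connected, loopless multigraph (parallel edges allowed); its genus is $g=|E(G)|-|V(G)|+1$; it is bridgeless if it is 2-edge-connected. A divisor on $G$ is an element of the free abelian group on $V(G)$. Linear equivalence $\sim$ is generated by chip-firing (firing $w$ subtracts $\mathrm{val}(w)$ chips from $w$ and adds to each other vertex the number of edges joining it to $w$). $|D|$ is the set of effective divisors equivalent to $D$. The rank $r(D)$ is $-1$ if $|D|=\emptyset$, else the largest $r\ge0$ such that $|D-E|\neq\emptyset$ for every effective $E$ of degree $r$. $\mathrm{Jac}(G)$ is the group of degree-$0$ divisor classes. $\delta(P)$ is $1$ if $P$ holds and $0$ otherwise. A twice-marked graph $(G,u,v)$ is a graph with two chosen vertices; its torsion order is the least $k\ge1$ with $ku\sim kv$. A twist of $D$ is $D+au+bv$, $a,b\in\mathbb Z$. $\Delta(D)=r(D)-r(D-u)-r(D-v)+r(D-u-v)$. $D$ is submodular if $\Delta(D')\ge0$ for all twists $D'$. If $D$ is submodular, its transmission permutation $\tau^{u,v}_D$ is the unique bijection $\mathbb Z\to\mathbb Z$ with $\delta(\tau^{u,v}_D(b)=a)=\Delta(D+au-bv)$ for all $a,b$. An inversion of a bijection $\tau$ is a pair $(a,b)$ with $a<b$, $\tau(a)>\tau(b)$; two inversions $(a,b),(a',b')$ are $k$-equivalent if $a-a'=b-b'\equiv0\pmod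 k$; $\mathrm{inv}_k(\tau)$ is the number of $k$-equivalence classes of inversions. A genus-$g$ twice-marked graph has $k$-general transmission if $ku\sim kv$, every divisor is submodular, and $\mathrm{inv}_k(\tau^{u,v}_D)\le g$ for every divisor $D$. $(G,u,v)$ is rigidly marked if every divisor on $G$ is submodular and $r(u+v)=0$. A degree-$0$ class $[D]\in\mathrm{Jac}(G)$ of order $k$ is non-recurrent if for every vertex $w\in V(G)$ there is at most one integer $n\in\{1,\dots,k-1\}$ with $|nD+w|\ne\emptyset$. *)

(* Defs.v *)
From Stdlib Require Import ClassicalEpsilon.
From mathcomp Require Import all_boot all_order all_algebra.
Set Implicit Arguments. Unset Strict Implicit. Unset Printing Implicit Defensive.
Import Order.TTheory GRing.Theory Num.Theory.
Local Open Scope ring_scope.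

(* A multigraph on the finite vertex type V is given by its edge-multiplicity
   function m : m x y = number of edges joining x and y. *)
Section Graphs.
Variable V : finType.
Implicit Types (m : V -> V -> nat).

Definition adj m : rel V := fun x y => (0 < m x y)%N.

Definition is_graph m : Prop :=
  (forall x y, m x y = m y x) /\ (forall x, m x x = 0%N) /\
  (forall x y, connect (adj m) x y).

Definition remove_edge m (x y : V) : V -> V -> nat := fun a b =>
  if ((a == x) && (b == y)) || ((a == y) && (b == x)) then (m a b).-1 else m a b.

Definition bridgeless m : Prop :=
  forall x y, (0 < m x y)%N -> forall a b, connect (adj (remove_edge m x y)) a b.

Definition nedges m : nat := ((\sum_(x : V) \sum_(y : V) m x y) %/ 2)%N.

Definition genus m : int := (nedges m)%:Z - (#|V|)%:Z + 1.

Definition valence m (w : V) : nat := (\sum_(x : V) m w x)%N.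

Definition divisor := V -> int.
Definition chip (u : V) : divisor := fun w => ((w == u) : nat)%:Z.
Definition dadd (D E : divisor) : divisor := fun w => D w + E w.
Definition dsub (D E : divisor) : divisor := fun w => D w - E w.
Definition dscale (n : int) (D : divisor) : divisor := fun w => n * D w.
Definition dzero : divisor := fun _ => 0.
Definition deg (D : divisor) : int := \sum_(w : V) D w.
Definition effective (D : divisor) : Prop := forall w, 0 <= D w.

(* linear equivalence: D' is obtained from D by firing each vertex x
   f x times (an integer, negative meaning reverse firing) *)
Definition lin_equiv m (D D' : divisor) : Prop :=
  exists f : V -> int, forall w,
    D' w = D w - f w * (valence m w)%:Z + \sum_(x : V) f x * (m x w)%:Z.

Definition linsys_nonempty m (D : divisor) : Prop :=
  exists E, effective E /\ lin_equiv m D E.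

Definition rank_ge m (D : divisor) (n : nat) : Prop :=
  forall E, effective E -> deg E = n%:Z -> linsys_nonempty m (dsub D E).

Definition rank_spec m (D : divisor) (r : int) : Prop :=
  (r = -1 /\ ~ linsys_nonempty m D) \/
  (linsys_nonempty m D /\ 0 <= r /\ rank_ge m D `|r|%N /\
     forall n : nat, rank_ge m D n -> n%:Z <= r).

(* the rank r(D): the unique r satisfying rank_spec *)
Definition rank m (D : divisor) : int :=
  epsilon (inhabits (-1)) (rank_spec m D).

Definition Delta m (u v : V) (D : divisor) : int :=
  rank m D - rank m (dsub D (chip u)) - rank m (dsub D (chip v))
  + rank m (dsub (dsub D (chip u)) (chip v)).

Definition twist (u v : V) (D : divisor) (a b : int) : divisor :=
  dadd (dadd D (dscale a (chip u))) (dscale b (chip v)).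

Definition submodular m (u v : V) (D : divisor) : Prop :=
  forall a b : int, 0 <= Delta m u v (twist u v D a b).

Definition is_transmission_perm m (u v : V) (D : divisor) (tau : int -> int) : Prop :=
  bijective tau /\
  forall a b : int, ((tau b == a) : nat)%:Z = Delta m u v (twist u v D a (- b)).

Definition inversion (tau : int -> int) (a b : int) : Prop :=
  a < b /\ tau b < tau a.

Definition k_equiv (k : nat) (p q : int * int) : Prop :=
  p.1 - q.1 = p.2 - q.2 /\ (k%:Z %| (p.1 - q.1))%Z.

(* inv_k(tau) <= g : the inversions fall into at most g k-equivalence classes *)
Definition inv_k_le (tau : int -> int) (k : nat) (g : int) : Prop :=
  exists s : seq (int * int), (size s)%:Z <= g /\
    forall a b, inversion tau a b ->
      exists2 q, q \in s & inversion tau q.1 q.2 /\ k_equiv k (a, b) q.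

Definition torsion_order m (u v : V) (k : nat) : Prop :=
  (0 < k)%N /\ lin_equiv m (dscale k%:Z (chip u)) (dscale k%:Z (chip v)) /\
  forall j : nat, (0 < j < k)%N ->
    ~ lin_equiv m (dscale j%:Z (chip u)) (dscale j%:Z (chip v)).

Definition k_general_transmission m (u v : V) (k : nat) : Prop :=
  lin_equiv m (dscale k%:Z (chip u)) (dscale k%:Z (chip v)) /\
  (forall D, submodular m u v D) /\
  (forall D, exists tau, is_transmission_perm m u v D tau /\ inv_k_le tau k (genus m)).

Definition rigidly_marked m (u v : V) : Prop :=
  (forall D, submodular m u v D) /\ rank m (dadd (chip u) (chip v)) = 0.

Definition class_order m (D : divisor) (k : nat) : Prop :=
  (0 < k)%N /\ lin_equiv m (dscale k%:Z D) dzero /\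
  forall j : nat, (0 < j < k)%N -> ~ lin_equiv m (dscale j%:Z D) dzero.

Definition non_recurrent m (D : divisor) : Prop :=
  forall k, class_order m D k ->
  forall (w : V) (n1 n2 : nat), (0 < n1 < k)%N -> (0 < n2 < k)%N ->
    linsys_nonempty m (dadd (dscale n1%:Z D) (chip w)) ->
    linsys_nonempty m (dadd (dscale n2%:Z D) (chip w)) -> n1 = n2.

End Graphs.

(* Main.v *)
From Stdlib Require Import ClassicalEpsilon.
Require Import Defs.
From mathcomp Require Import all_boot all_order all_algebra zify ring.
Set Implicit Arguments. Unset Strict Implicit. Unset Printing Implicit Defensive.
Import Order.TTheory GRing.Theory Num.Theory.
Local Open Scope ring_scope.

(* Put [F a b = r(D + a u - b v)] and [d = deg D]. In genus 2, [F a b] is [-1] in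
   negative degree, is [deg - 2] in degree at least 3 and is at most [0] in degree 1, so
   submodularity produces the permutation [tau] with [F a b - F a (b + 1) = 1] exactly
   when [tau b <= a]. Shift [tau] to [s b = tau b + d - 2]. For the degree 1 divisor
   [A c = D + (c - d + 1) u - c v], summing these differences down to degree [-1] and up
   to degree 3 gives
     [r(A c) + 1 = #{b >= c | s b < c} = #{b < c | s b >= c}],
   which is at most 1. Hence an effective [A c] singles out the unique inversion of [s]
   that straddles the cut [c] both in its positions and in its values. Rigidity forbids
   [s x = x - 2] together with [s (x - 2) = x], and this makes every inversion straddle
   exactly one cut. So [inv_k tau] counts the effective classes in the orbit of [A 0]
   under translation by [u - v], and non-recurrence says that every such orbit contains
   at most two of them. *)

(** * Inversions of a permutation of the integers that stays within distance 2 of the diagonal *)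

Section Cuts.
Variable s : int -> int.

Definition crosses (c a b : int) : Prop := (a < c /\ c <= b) /\ (s b < c /\ c <= s a).

(** By [s_near], a position [b >= c] with [s b < c] can only be [c] or [c + 1], so two terms give
    the whole count. [ascents] counts the positions left of the cut with values at or above it,
    again among two candidates. *)
Definition descents (c : int) : nat := ((s c < c)%R + (s (c + 1) < c)%R)%N.
Definition ascents (c : int) : nat := ((c <= s (c - 1))%R + (c <= s (c - 2))%R)%N.

Hypothesis s_inj : injective s.
Hypothesis s_near : forall b, - 2 <= s b - b /\ s b - b <= 2.
Hypothesis descents_le1 : forall c, (descents c <= 1)%N.
Hypothesis ascents_descents : forall c, ascents c = descents c.
Hypothesis s_rigid : forall x, ~ (s x = x - 2 /\ s (x - 2) = x).

Lemma crosses_inversion c a b : crosses c a b -> inversion s a b.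
Proof. by case=> [[? ?] [? ?]]; split; lia. Qed.

Lemma descent_uniq c b b' : c <= b -> s b < c -> c <= b' -> s b' < c -> b = b'.
Proof.
move=> cb sb cb' sb'.
have hb : b = c \/ b = c + 1 by have := s_near b; lia.
have hb' : b' = c \/ b' = c + 1 by have := s_near b'; lia.
have := descents_le1 c; rewrite /descents.
case: hb hb' => e [] e'; subst b b'; lia.
Qed.

Lemma ascent_uniq c a a' : a < c -> c <= s a -> a' < c -> c <= s a' -> a = a'.
Proof.
move=> ac sa ac' sa'.
have ha : a = c - 1 \/ a = c - 2 by have := s_near a; lia.
have ha' : a' = c - 1 \/ a' = c - 2 by have := s_near a'; lia.
have := descents_le1 c; rewrite -ascents_descents /ascents.
case: ha ha' => e [] e'; subst a a'; lia.
Qed.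

Lemma crosses_descents c a b : crosses c a b -> descents c = 1%N.
Proof.
case=> [[ac cb] [sb sa]].
have hb : b = c \/ b = c + 1 by have := s_near b; lia.
have := descents_le1 c; rewrite /descents.
by case: hb => e; subst b; lia.
Qed.

Lemma descents_crosses c : descents c = 1%N -> exists a b, crosses c a b.
Proof.
move=> h; have h' := ascents_descents c; rewrite h in h'.
have [b [cb sb]] : exists b, c <= b /\ s b < c.
  move: h; rewrite /descents; case: (ltP (s c) c) => [? _|_ h].
    by exists c; lia.
  by exists (c + 1); lia.
have [a [ac sa]] : exists a, a < c /\ c <= s a.
  move: h'; rewrite /ascents; case: (leP c (s (c - 1))) => [? _|_ h'].
    by exists (c - 1); lia.
  by exists (c - 2); lia.
by exists a, b.
Qed.

Lemma crosses_uniq c a b a' b' : crosses c a b -> crosses c a' b' -> a = a' /\ b = b'.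
Proof.
move=> [[ac cb] [sb sa]] [[ac' cb'] [sb' sa']].
by split; [apply: (@ascent_uniq c) | apply: (@descent_uniq c)].
Qed.

(** Two cuts force [b - a >= 2] and [s a - s b >= 2]. The bounds of [s_near] then leave only
    [s b = b - 2] and [s (b - 2) = b], the pattern excluded by [s_rigid]. *)
Lemma cut_uniq c c' a b : crosses c a b -> crosses c' a b -> c = c'.
Proof.
suff H x y : crosses x a b -> crosses y a b -> ~ x < y.
  by move=> h h'; have := H _ _ h h'; have := H _ _ h' h; lia.
move=> [[ac cb] [sb sa]] [[ac' cb'] [sb' sa']] lt_xy.
have na := s_near a; have nb := s_near b.
apply: (s_rigid (x := b)); have -> : b - 2 = a by lia.
lia.
Qed.

Lemma descent_partner c b : c <= b -> s b < c -> exists a, crosses c a b.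
Proof.
move=> cb sb.
have hb : b = c \/ b = c + 1 by have := s_near b; lia.
have h : descents c = 1%N.
  by have := descents_le1 c; rewrite /descents; case: hb => e; subst b; lia.
have [a [b' h']] := descents_crosses h.
exists a; suff -> : b = b' by [].
by case: h' => [[? ?] [? ?]]; apply: (@descent_uniq c).
Qed.

Lemma ascent_partner c a : a < c -> c <= s a -> exists b, crosses c a b.
Proof.
move=> ac sa.
have ha : a = c - 1 \/ a = c - 2 by have := s_near a; lia.
have h : descents c = 1%N.
  have := descents_le1 c; rewrite -ascents_descents /ascents.
  by case: ha => e; subst a; lia.
have [a' [b h']] := descents_crosses h.
exists b; suff -> : a = a' by [].
by case: h' => [[? ?] [? ?]]; apply: (@ascent_uniq c).
Qed.

(** A cut exists as soon as [a < s a] and [s b < b]. If [s a < a], then [a] and [b] are two descents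
    at the cut [a]. If [s a = a], then [b] descends across both [a] and [a + 1], and by injectivity
    with the same partner, against [cut_uniq]. The bound for [b] is symmetric. *)
Lemma inversion_crosses a b : inversion s a b -> exists c, crosses c a b.
Proof.
case=> ab sab.
have lt_a : a < s a.
  rewrite ltNge; apply/negP => le_a.
  have eq_a : s a = a.
    apply/eqP; rewrite eq_le le_a leNgt; apply/negP => lt_sa.
    have := @descent_uniq a a b; lia.
  have [x hx] := @descent_partner a b ltac:(lia) ltac:(lia).
  have [y hy] := @descent_partner (a + 1) b ltac:(lia) ltac:(lia).
  have [ax|ax] : s x = a \/ a + 1 <= s x by case: hx => [[? ?] [? ?]]; lia.
    have : x = a by apply: s_inj; rewrite ax eq_a.
    by case: hx => [[? ?] _]; lia.
  have hx' : crosses (a + 1) x b by case: hx => [[? ?] [? ?]]; split; lia.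
  by have := cut_uniq hx hx'; lia.
have lt_b : s b < b.
  rewrite ltNge; apply/negP => le_b.
  have eq_b : s b = b.
    apply/eqP; rewrite eq_le le_b andbT leNgt; apply/negP => lt_sb.
    have := @ascent_uniq (b + 1) a b; lia.
  have [x hx] := @ascent_partner b a ltac:(lia) ltac:(lia).
  have [y hy] := @ascent_partner (b + 1) a ltac:(lia) ltac:(lia).
  have [bx|bx] : x = b \/ b + 1 <= x by case: hx => [[? ?] [? ?]]; lia.
    by case: hx => [_ [? ?]]; subst x; lia.
  have hx' : crosses (b + 1) a x by case: hx => [[? ?] [? ?]]; split; lia.
  by have := cut_uniq hx hx'; lia.
by exists (Num.min b (s a)); split; split; lia.
Qed.

Variable k : nat.
Hypothesis s_periodic : forall x, s (x + k%:Z) = s x + k%:Z.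

Lemma s_shift x j : s (x + j * k%:Z) = s x + j * k%:Z.
Proof.
have shiftn y (n : nat) : s (y + n%:Z * k%:Z) = s y + n%:Z * k%:Z.
  elim: n => [|n IHn]; first by rewrite !mul0r !addr0.
  have -> : y + n.+1%:Z * k%:Z = y + n%:Z * k%:Z + k%:Z by lia.
  by rewrite s_periodic IHn; lia.
case: (intP j) => [|n|n]; [exact: shiftn 0%N | exact: shiftn |].
have := shiftn (x + - n.+1%:Z * k%:Z) n.+1.
have -> : x + - n.+1%:Z * k%:Z + n.+1%:Z * k%:Z = x by ring.
by move=> ->; ring.
Qed.

Lemma crosses_shift c a b j : crosses c a b ->
  crosses (c + j * k%:Z) (a + j * k%:Z) (b + j * k%:Z).
Proof. by case=> [[? ?] [? ?]]; rewrite /crosses !s_shift; split; lia. Qed.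

Lemma k_equiv_shift p q : k_equiv k p q <->
  exists j, p.1 = q.1 + j * k%:Z /\ p.2 = q.2 + j * k%:Z.
Proof.
case: p q => [a b] [a' b']; rewrite /k_equiv /=; split=> [[e /dvdzP[j ej]]|[j [-> ->]]].
  by exists j; lia.
split; first by ring.
by apply/dvdzP; exists j; ring.
Qed.

(** Translation by multiples of [k] carries crossings to crossings, and an inversion and its cut
    determine each other. *)
Lemma k_equiv_cuts c c' a b a' b' : crosses c a b -> crosses c' a' b' ->
  k_equiv k (a, b) (a', b') <-> (k%:Z %| c - c')%Z.
Proof.
move=> h h'; split=> [/k_equiv_shift[j /= [ea eb]]|/dvdzP[j ej]].
  apply/dvdzP; exists j; rewrite ea eb in h.
  by have := cut_uniq h (crosses_shift j h'); lia.
apply/k_equiv_shift; exists j => /=.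
have e : c = c' + j * k%:Z by lia.
by rewrite e in h; apply: crosses_uniq h (crosses_shift j h').
Qed.

(* Each inversion crosses exactly one cut and each cut with a descent is crossed
   by exactly one inversion, so counting inversions is counting such cuts. *)
Lemma inv_k_le2 : inv_k_le s k 2 <-> forall c1 c2 c3,
  descents c1 = 1%N -> descents c2 = 1%N -> descents c3 = 1%N ->
  [\/ (k%:Z %| c1 - c2)%Z, (k%:Z %| c1 - c3)%Z | (k%:Z %| c2 - c3)%Z].
Proof.
split=> [[l [size_l inl]] c1 c2 c3|H].
  have repr c : descents c = 1%N -> exists2 q, q \in l & exists c',
      crosses c' q.1 q.2 /\ (k%:Z %| c - c')%Z.
    move=> /descents_crosses[a [b h]].
    have [[a' b'] ql [qinv qeq]] := inl a b (crosses_inversion h).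
    have [c' h'] := inversion_crosses qinv.
    by exists (a', b') => //; exists c'; split=> //; apply/(k_equiv_cuts h h').
  have same q c c' d d' : crosses c' q.1 q.2 /\ (k%:Z %| c - c')%Z ->
      crosses d' q.1 q.2 /\ (k%:Z %| d - d')%Z -> (k%:Z %| c - d)%Z.
    move=> [h hc] [h' hd]; have e := cut_uniq h h'; subst d'.
    have -> : c - d = (c - c') - (d - c') by ring.
    exact: rpredB.
  move=> /repr[q1 l1 [d1 h1]] /repr[q2 l2 [d2 h2]] /repr[q3 l3 [d3 h3]].
  (* Pigeonhole: three representatives in a list of length at most 2. *)
  have : [\/ q1 = q2, q1 = q3 | q2 = q3].
    case: l size_l l1 l2 l3 {inl repr} => [|x [|y [|z l]]] //= _; rewrite !inE.
      by move=> /eqP-> /eqP-> _; constructor 1.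
    move=> /orP[]/eqP-> /orP[]/eqP-> /orP[]/eqP->;
      by [constructor 1 | constructor 2 | constructor 3].
  case=> e; [constructor 1 | constructor 2 | constructor 3].
  - by rewrite e in h1; apply: same h1 h2.
  - by rewrite e in h1; apply: same h1 h3.
  - by rewrite e in h2; apply: same h2 h3.
have [[c1 h1]|no] := classic (exists c, descents c = 1%N); last first.
  exists [::]; split=> // a b /inversion_crosses[c hc].
  by case: no; exists c; apply: crosses_descents hc.
have [a1 [b1 x1]] := descents_crosses h1.
(* Take [c2] in a class other than that of [c1], if there is one; by [H] any further cut with a
   descent is then congruent to [c1] or [c2]. *)
have [[c2 [h2 n12]]|all1] :=
  classic (exists c, descents c = 1%N /\ ~~ (k%:Z %| c1 - c)%Z); last first.
  exists [:: (a1, b1)]; split=> // a b /inversion_crosses[c hc].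
  exists (a1, b1); first by rewrite inE.
  split; first exact: crosses_inversion x1.
  apply/(k_equiv_cuts hc x1); rewrite -opprB rpredN; apply/negbNE/negP => nc.
  by apply: all1; exists c; split=> //; apply: crosses_descents hc.
have [a2 [b2 x2]] := descents_crosses h2.
exists [:: (a1, b1); (a2, b2)]; split=> // a b /inversion_crosses[c hc].
have [|h|h] := H c1 c2 c h1 h2 (crosses_descents hc).
- by rewrite (negbTE n12).
- exists (a1, b1); first by rewrite inE eqxx.
  split; first exact: crosses_inversion x1.
  by apply/(k_equiv_cuts hc x1); rewrite -opprB rpredN.
exists (a2, b2); first by rewrite !inE eqxx orbT.
split; first exact: crosses_inversion x2.
by apply/(k_equiv_cuts hc x2); rewrite -opprB rpredN.
Qed.

End Cuts.

(** * Maxima of bounded sets of integers, and sets closed along paths *)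

Lemma int_has_max (P : int -> Prop) (B : int) :
  (forall x, P x -> x <= B) -> (exists x, P x) ->
  exists x, P x /\ forall y, P y -> y <= x.
Proof.
move=> leB [x0 Px0].
have [n] : exists n : nat, B - x0 <= n%:Z by exists `|B - x0|%N; lia.
elim: n x0 Px0 => [|n IHn] x Px hx.
  by exists x; split=> // y /leB; lia.
have [[y [Py xy]]|no] := classic (exists y, P y /\ x < y).
  by apply: (IHn y) => //; lia.
exists x; split=> // y Py; rewrite leNgt; apply/negP => xy.
by apply: no; exists y.
Qed.

Lemma connect_stable (T : finType) (e : rel T) (A : pred T) x y :
  (forall a b, A a -> e a b -> A b) -> connect e x y -> A x -> A y.
Proof.
move=> clA /connectP[p e_p ->] {y}.
by elim: p x e_p => //= b p IHp x /andP[exb e_p] /clA/(_ exb); apply: IHp.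
Qed.

(** * The graph Laplacian and linear equivalence *)

Section Laplacian.
Variables (V : finType) (m : V -> V -> nat).
Hypothesis m_graph : is_graph m.
Implicit Types (D E : divisor V) (f : V -> int).

Let m_sym x y : m x y = m y x. Proof. by case: m_graph. Qed.
Let m_conn x y : connect (adj m) x y. Proof. by case: m_graph => _ []. Qed.

(** Chips lost at [w] when every [x] fires [f x] times. Written with differences, it makes the
    maximum principle visible: at a maximum of [f] every term is nonnegative. *)
Definition lap f w : int := \sum_x (f w - f x) * (m w x)%:Z.

Definition indic (A : pred V) : V -> int := fun w => (A w : nat)%:Z.

Lemma lin_equivP D D' :
  lin_equiv m D D' <-> exists f, forall w, D' w = D w - lap f w.
Proof.
have E f w : lap f w = f w * (valence m w)%:Z - \sum_x f x * (m x w)%:Z.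
  rewrite /lap /valence -[(\sum_x m w x)%N%:Z]natz natr_sum mulr_sumr -sumrB.
  by apply: eq_bigr => x _; rewrite natz (m_sym w x); ring.
by split=> -[f Hf]; exists f => w; rewrite Hf E; ring.
Qed.

Lemma lap_lin (c : int) f g w :
  lap (fun x => c * f x + g x) w = c * lap f w + lap g w.
Proof. by rewrite /lap mulr_sumr -big_split; apply: eq_bigr => x _ /=; ring. Qed.

Lemma lap_sum (I : finType) (c : I -> int) (F : I -> V -> int) w :
  lap (fun x => \sum_i c i * F i x) w = \sum_i c i * lap (F i) w.
Proof.
rewrite /lap; under eq_bigr => x _ do rewrite -sumrB mulr_suml.
rewrite exchange_big; apply: eq_bigr => i _ /=.
by rewrite mulr_sumr; apply: eq_bigr => x _; ring.
Qed.

Lemma sum_lap f : \sum_w lap f w = 0.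
Proof.
suff : \sum_w lap f w = - \sum_w lap f w by lia.
rewrite [LHS]exchange_big -sumrN /=; apply: eq_bigr => x _.
rewrite /lap -sumrN; apply: eq_bigr => y _.
by rewrite (m_sym x y); ring.
Qed.

Lemma lap_indic_in (A : pred V) w : A w ->
  lap (indic A) w = \sum_(x | ~~ A x) (m w x)%:Z.
Proof.
move=> Aw; rewrite /lap /indic Aw [RHS]big_mkcond; apply: eq_bigr => x _ /=.
by case: (A x) => /=; ring.
Qed.

Lemma lap_indic_out (A : pred V) w : ~~ A w ->
  lap (indic A) w = - \sum_(x | A x) (m w x)%:Z.
Proof.
move=> /negbTE nAw; rewrite /lap /indic nAw [in RHS]big_mkcond -sumrN.
by apply: eq_bigr => x _ /=; case: (A x) => /=; ring.
Qed.

(** Since [f] is integer-valued, it drops by at least 1 on leaving [A], so the terms dominate those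
    of the indicator of [A]. *)
Lemma lap_ge_out (A : pred V) f w : A w ->
  (forall x, f x <= f w) -> (forall x, ~~ A x -> f x < f w) ->
  \sum_(x | ~~ A x) (m w x)%:Z <= lap f w.
Proof.
move=> Aw fle flt; rewrite -lap_indic_in // /lap; apply: ler_sum => x _.
apply: ler_wpM2r => //; rewrite /indic Aw.
by case Ax : (A x); [have := fle x; lia | have := flt x; rewrite Ax; lia].
Qed.

Lemma deg_lap D f : @deg V (fun w => D w - lap f w) = deg D.
Proof. by rewrite /deg sumrB sum_lap subr0. Qed.

Lemma deg_ext D E : (forall w, D w = E w) -> deg D = deg E.
Proof. by move=> DE; apply: eq_bigr. Qed.

Lemma deg_add D E : deg (dadd D E) = deg D + deg E.
Proof. by rewrite /deg big_split. Qed.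

Lemma deg_sub D E : deg (dsub D E) = deg D - deg E.
Proof. by rewrite /deg sumrB. Qed.

Lemma deg_scale n D : deg (dscale n D) = n * deg D.
Proof. by rewrite /deg mulr_sumr. Qed.

Lemma deg_chip (x : V) : deg (chip x) = 1.
Proof.
rewrite /deg (bigD1 x) //= /chip eqxx big1 // => w /negbTE ->.
by [].
Qed.

Lemma deg_eff D : effective D -> 0 <= deg D.
Proof. by move=> D0; apply: sumr_ge0. Qed.

Lemma chip_eff (x : V) : effective (chip x).
Proof. by []. Qed.

Lemma lin_equiv_ext D E : (forall w, D w = E w) -> lin_equiv m D E.
Proof.
move=> DE; apply/lin_equivP; exists (fun=> 0) => w.
by rewrite DE /lap big1 ?subr0 // => x _; rewrite subr0 mul0r.
Qed.

Lemma lin_equiv_refl D : lin_equiv m D D.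
Proof. exact: lin_equiv_ext. Qed.

Lemma lin_equiv_lin c D D' E E' : lin_equiv m D D' -> lin_equiv m E E' ->
  lin_equiv m (dadd (dscale c D) E) (dadd (dscale c D') E').
Proof.
move=> /lin_equivP[f Hf] /lin_equivP[g Hg]; apply/lin_equivP.
exists (fun x => c * f x + g x) => w.
by rewrite lap_lin /dadd /dscale Hf Hg; ring.
Qed.

Lemma lin_equiv_trans D2 D1 D3 :
  lin_equiv m D1 D2 -> lin_equiv m D2 D3 -> lin_equiv m D1 D3.
Proof.
move=> /lin_equivP[f Hf] /lin_equivP[g Hg]; apply/lin_equivP.
exists (fun x => 1 * f x + g x) => w.
by rewrite lap_lin Hg Hf; ring.
Qed.

Lemma lin_equiv_sym D E : lin_equiv m D E -> lin_equiv m E D.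
Proof.
move=> /lin_equivP[f Hf]; apply/lin_equivP.
exists (fun x => (-1) * f x + 0) => w.
by rewrite lap_lin Hf /lap [\sum_x (0 - 0) * _]big1 => [|x _]; ring.
Qed.

Lemma lin_equiv_sub D D' E E' : lin_equiv m D D' -> lin_equiv m E E' ->
  lin_equiv m (dsub D E) (dsub D' E').
Proof.
move=> hD hE; have := lin_equiv_lin (-1) hE hD.
by move=> h; apply: (lin_equiv_trans _ (lin_equiv_trans h _));
  apply: lin_equiv_ext => w; rewrite /dadd /dsub /dscale; ring.
Qed.

Lemma lin_equiv_deg D E : lin_equiv m D E -> deg D = deg E.
Proof.
by move=> /lin_equivP[f Hf]; rewrite -(deg_lap D f); apply: deg_ext => w.
Qed.

Lemma linsys_equiv D E : lin_equiv m D E -> linsys_nonempty m D -> linsys_nonempty m E.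
Proof.
move=> DE [F [F0 DF]]; exists F; split=> //.
exact: lin_equiv_trans (lin_equiv_sym DE) DF.
Qed.

Lemma linsys_add D E : effective E -> linsys_nonempty m D -> linsys_nonempty m (dadd D E).
Proof.
move=> E0 [F [F0 /lin_equivP[f Hf]]]; exists (dadd F E); split.
  by move=> w; rewrite /dadd addr_ge0.
by apply/lin_equivP; exists f => w; rewrite /dadd Hf; ring.
Qed.

Lemma linsys_deg D : linsys_nonempty m D -> 0 <= deg D.
Proof. by move=> [E [E0 /lin_equiv_deg ->]]; apply: deg_eff. Qed.

Lemma linsys_deg0 D : linsys_nonempty m D -> deg D = 0 -> lin_equiv m D (@dzero V).
Proof.
move=> [E [E0 DE]] D0; apply: (lin_equiv_trans DE); apply: lin_equiv_ext => w.
have : deg E = 0 by rewrite -(lin_equiv_deg DE).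
by move/eqP; rewrite psumr_eq0 // => /allP/(_ w (mem_index_enum w))/eqP.
Qed.

Lemma linsys_deg1 D : linsys_nonempty m D -> deg D = 1 ->
  exists w, lin_equiv m D (chip w).
Proof.
move=> [E [E0 DE]] D1.
have E1 : deg E = 1 by rewrite -(lin_equiv_deg DE).
have [w Ew] : exists w, 1 <= E w.
  have [/existsP[w]|/existsPn no] := boolP [exists w, 1 <= E w]; first by exists w.
  move: E1; rewrite /deg big1 // => w _.
  by have := no w; have := E0 w; lia.
exists w; apply: (lin_equiv_trans DE); apply: lin_equiv_ext => x.
have : \sum_y (E y - chip w y) == 0 by rewrite sumrB -!/(deg _) E1 deg_chip subrr.
have ge0 y : 0 <= E y - chip w y.
  by rewrite /chip; case: eqP => [->|_]; [lia | have := E0 y; lia].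
rewrite psumr_eq0 // => /allP/(_ x (mem_index_enum x)) /=.
by rewrite subr_eq0 => /eqP.
Qed.

(* At the maxima of [f] at least the edges leaving them are fired across, and a
   single chip can pay for one edge only, which would have to be a bridge. *)
Lemma chip_inj x y : bridgeless m -> lin_equiv m (chip x) (chip y) -> x = y.
Proof.
move=> m_bridgeless /lin_equivP[f Hf].
case: (arg_maxP f (P := predT) (i0 := x)) => // z _ zmax'.
have zmax t : f t <= f z by apply: zmax'.
pose A := [pred w | f w == f z].
have out w : A w -> \sum_(t | ~~ A t) (m w t)%:Z <= ((w == x) : nat)%:Z.
  move=> Aw; apply: le_trans (_ : lap f w <= _).
    apply: lap_ge_out => //= t; rewrite (eqP Aw); first exact: zmax.
    by move=> ne; rewrite lt_neqAle ne zmax.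
  by have := Hf w; rewrite /chip; lia.
have out1 w t : A w -> ~~ A t -> (m w t <= (w == x))%N.
  move=> Aw nAt; have := out w Aw; rewrite (bigD1 t) //=; set r := (X in _ + X <= _).
  have : 0 <= r by apply: sumr_ge0.
  lia.
have [/existsP[t nAt]|/existsPn allA] := boolP [exists t, ~~ A t]; last first.
  have := Hf x; rewrite /chip eqxx /lap big1.
    by case: eqP => //; lia.
  move=> t _; have := allA t; have := allA x; rewrite !negbK /= => /eqP-> /eqP->.
  by rewrite subrr mul0r.
have [a /andP[Aa /existsP[b /andP[nAb ab]]]] :
    exists a, A a && [exists b, ~~ A b && adj m a b].
  apply/existsP/negbNE/negP => no.
  have /negP := nAt; apply; apply: (connect_stable _ (m_conn z t)); last exact: eqxx.
  move=> a b Aa ab; apply/negbNE/negP => nAb; move/negP: no; apply.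
  by apply/existsP; exists a; rewrite Aa; apply/existsP; exists b; rewrite nAb.
have ax : a = x by have := out1 a b Aa nAb; move: ab; rewrite /adj; case: eqP => //; lia.
subst a.
(* The set [A] is closed along the edges that survive the removal of one edge between [x] and [b],
   yet without bridges [x] still reaches [b], which lies outside [A]. *)
have := @connect_stable _ _ A x b _ (m_bridgeless x b ab x b) Aa.
rewrite (negbTE nAb) => H; suff : false by []; apply: H => w t' Aw; apply: contraTT => nAt'.
rewrite /adj /remove_edge -leqNgt leqn0.
have := out1 w t' Aw nAt'.
case: (w =P x) => [wx|_] /=.
  subst w; case: (t' =P b) => [->|ne] /= h; first by apply/eqP; lia.
  have -> : (x == b) = false by apply: contraNF nAb => /eqP <-.
  have := out x Aa; rewrite (bigD1 b) //= (bigD1 t') /=; last by rewrite nAt'; apply/eqP.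
  set r := (X in _ + (_ + X) <= _); have : 0 <= r by apply: sumr_ge0.
  by move: ab; rewrite /adj eqxx; lia.
have -> : (w == b) = false by apply: contraNF nAb => /eqP <-.
by rewrite /= => h; apply/eqP; lia.
Qed.

End Laplacian.

(** * Reduced divisors, acyclic orientations and Riemann's inequality *)

Section RiemannInequality.
Variables (V : finType) (m : V -> V -> nat).
Hypothesis m_graph : is_graph m.
Implicit Types (D E : divisor V) (f : V -> int).

Let m_sym x y : m x y = m y x. Proof. by case: m_graph. Qed.
Let m_irr x : m x x = 0%N. Proof. by case: m_graph => _ []. Qed.
Let m_conn x y : connect (adj m) x y. Proof. by case: m_graph => _ []. Qed.

(** Chips can be brought from [q] to any vertex with debt only at [q]. The property spreads along
    edges: once [a] can be fed, it can afford to fire towards its neighbour [b]. *)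
Lemma feed_vertex q x : exists f,
  (forall w, w != q -> lap m f w <= 0) /\ (x != q -> lap m f x <= -1).
Proof.
pose P x := exists f,
  (forall w, w != q -> lap m f w <= 0) /\ (x != q -> lap m f x <= -1).
pose A x : bool := if excluded_middle_informative (P x) then true else false.
have AP y : A y <-> P y by rewrite /A; case: excluded_middle_informative.
apply/AP; apply: (connect_stable (A := A) _ (m_conn q x)); last first.
  apply/AP; exists (fun=> 0); rewrite eqxx; split=> // w _.
  by rewrite /lap big1 // => y _; rewrite subrr mul0r.
move=> a b /AP[f [f0 fa]] ab; apply/AP.
have ba : (0 < m b a)%N by rewrite m_sym.
have ne_ba : b != a by apply: contraTneq ba => ->; rewrite m_irr.
have outE w : w != a -> lap m (indic (pred1 a)) w = - (m w a)%:Z.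
  by move=> wa; rewrite lap_indic_out //= big_pred1_eq.
have [qa|qa] := eqVneq a q.
  subst q; exists (indic (pred1 a)); split=> [w|] ?; rewrite outE //; lia.
(* The vertex [a] loses [c] chips by firing; [c] copies of [f] return at least that many. *)
pose c := \sum_(x | ~~ pred1 a x) (m a x)%:Z.
have c0 : 0 <= c by apply: sumr_ge0.
exists (fun y => c * f y + indic (pred1 a) y); split=> [w wq|bq]; rewrite lap_lin.
  have [->|wa] := eqVneq w a.
    by rewrite lap_indic_in /= ?eqxx // -/c; have := fa qa; nia.
  by rewrite outE //; have := f0 w wq; nia.
by rewrite outE //; have := f0 b bq; nia.
Qed.

Lemma effective_off q D : exists f, forall w, w != q -> 0 <= D w - lap m f w.
Proof.
have [F FP] := fin_all_exists (feed_vertex q).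
exists (fun y => \sum_x `|D x| * F x y) => w wq; rewrite lap_sum (bigD1 w) //=.
set r := \sum_(_ | _) _.
have r0 : r <= 0.
  by apply: sumr_le0 => x _; apply: mulr_ge0_le0 => //; case: (FP x) => + _; apply.
have [_ /(_ wq) h] := FP w.
have : `|D w| * lap m (F w) w <= - `|D w| by have : 0 <= `|D w| by []; nia.
by lia.
Qed.

(** Constants lie in the kernel of the Laplacian; the normalisation [f q = 0] removes them, so that
    these firing scripts can be bounded. *)
Definition nonneg_off q D f := f q = 0 /\ forall w, w != q -> 0 <= D w - lap m f w.

Lemma lap_const_shift f c w : lap m (fun y => f y - c) w = lap m f w.
Proof. by apply: eq_bigr => x _; ring. Qed.

Lemma nonneg_off_exists q D : exists f, nonneg_off q D f.
Proof.
have [f fP] := effective_off q D; exists (fun y => f y - f q); split.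
  by rewrite subrr.
by move=> w; rewrite lap_const_shift; apply: fP.
Qed.

(* Adding a large multiple of a strictly subharmonic [phi] makes [f] strictly
   subharmonic off [q], so the maximum is attained at [q]. *)
Lemma nonneg_off_bounded q D : exists B : V -> int,
  forall f, nonneg_off q D f -> forall w, f w <= B w.
Proof.
(* Starting from the constant [-1] gives [lap m phi <= -1] off [q]; the multiple [N] then exceeds
   every [D z]. *)
have [phi [phi0 phiP]] := nonneg_off_exists q (fun=> -1).
pose N := \sum_x `|D x| + 1.
exists (fun w => - (N * phi w)) => f [f0 fP] w.
pose g y := N * phi y + f y.
case: (arg_maxP g (P := predT) (i0 := w)) => // z _ zmax'.
have zmax t : g t <= g z by apply: zmax'.
have gw : g w <= g q.
  have [<-//|zq] := eqVneq z q; exfalso.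
  have g0 : 0 <= lap m g z.
    by apply: sumr_ge0 => x _; apply: mulr_ge0 => //; rewrite subr_ge0.
  have leN : D z + 1 <= N.
    rewrite /N (bigD1 z) //=; set r := \sum_(_ | _) _.
    by have : 0 <= r; [apply: sumr_ge0 | lia].
  have N1 : 1 <= N by rewrite /N lerDr; apply: sumr_ge0.
  by move: g0; rewrite /g lap_lin; have := phiP z zq; have := fP z zq; nia.
by move: gw; rewrite /g phi0 f0; lia.
Qed.

(* Dhar's burning condition: no set avoiding [q] can be fired legally. *)
Lemma reduced_exists q D : exists f, nonneg_off q D f /\
  forall A : {set V}, A != set0 -> q \notin A ->
    exists2 x, x \in A & D x - lap m f x < \sum_(y | y \notin A) (m x y)%:Z.
Proof.
have [B BP] := nonneg_off_bounded q D.
(* Choose a script with the largest total number of firings: a set that could still be fired legally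
   would increase this total. *)
have := @int_has_max (fun t => exists f, nonneg_off q D f /\ \sum_w f w = t)
  (\sum_w B w).
case=> [t [f [hf <-]]||t [[f [hf <-]] fmax]].
- by apply: ler_sum => w _; apply: BP.
- by have [f hf] := nonneg_off_exists q D; exists (\sum_w f w), f.
exists f; split=> // A A0 qA.
have [/existsP[x /andP[xA xlt]]|/existsPn no] :=
  boolP [exists x, (x \in A) && (D x - lap m f x < \sum_(y | y \notin A) (m x y)%:Z)].
  by exists x.
have /set0Pn[a aA] := A0.
pose f' y := 1 * f y + indic (mem A) y.
have hf' : nonneg_off q D f'.
  case: hf => fq fP; split; first by rewrite /f' fq /indic /= (negbTE qA) mulr0.
  move=> w wq; rewrite /f' lap_lin; have [wA|wA] := boolP (w \in A).
    by have := no w; rewrite wA lap_indic_in //=; lia.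
  rewrite lap_indic_out //; have := fP w wq.
  have : 0 <= \sum_(x | mem A x) (m w x)%:Z by apply: sumr_ge0.
  by lia.
have := fmax _ (ex_intro _ f' (conj hf' erefl)).
rewrite /f' big_split /= (bigD1 a (P := predT) (F := fun i => indic _ i)) //=.
have -> : \sum_i 1 * f i = \sum_i f i by apply: eq_bigr => i _; rewrite mul1r.
rewrite {1}/indic /= aA; set r := (X in _ + (_ + X) <= _).
by have : 0 <= r; [apply: sumr_ge0 | lia].
Qed.

(* Outdegree minus one in the acyclic orientation towards smaller values of [p]. *)
Definition orientation_divisor (p : V -> nat) : divisor V :=
  fun x => \sum_(y | (p y < p x)%N) (m x y)%:Z - 1.

(** Reduce [D] at [q] and burn the graph from [q]; [p] records the order in which vertices catch
    fire. A vertex burns when it has fewer chips than burnt edges, which is the required bound. *)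
Lemma nonspecial_dominates D : ~ linsys_nonempty m D -> #|V| != 0%N ->
  exists p f, injective p /\ forall w, D w - lap m f w <= orientation_divisor p w.
Proof.
move=> noneff; rewrite -lt0n => /card_gt0P[q _].
have [f [[fq fP] fred]] := reduced_exists q D.
pose D' w := D w - lap m f w.
have burn n (A : {set V}) : #|A| = n -> q \notin A -> exists p : V -> nat,
    [/\ forall x, (0 < p x)%N = (x \in A), {in A &, injective p} &
        {in A, forall x, D' x < \sum_(y | (p y < p x)%N) (m x y)%:Z}].
  elim: n A => [|n IHn] A cA qA.
    have A0 : A = set0 by apply/eqP; rewrite -cards_eq0 cA.
    by exists (fun=> 0%N); split=> x; rewrite A0 in_set0.
  have [|x xA xlt] := fred A _ qA; first by rewrite -cards_eq0 cA.
  have [||p [p0 pinj pP]] := IHn (A :\ x).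
  - by have := cardsD1 x A; rewrite xA cA => -[->].
  - by rewrite in_setD1 (negbTE qA) andbF.
  (* Outside [A] everything has burnt at time 0; [x] burns next, and the order on the rest of [A] is
     delayed by one. *)
  pose p' y := if y == x then 1%N else if y \in A then (p y).+1 else 0%N.
  have p'x : p' x = 1%N by rewrite /p' eqxx.
  have p'A y : y != x -> y \in A -> p' y = (p y).+1 /\ (0 < p y)%N.
    by move=> yx yA; rewrite /p' (negbTE yx) yA p0 in_setD1 yx yA.
  have p'out y : y \notin A -> p' y = 0%N.
    move=> yA; rewrite /p' (negbTE yA); case: eqP => // yx.
    by rewrite yx xA in yA.
  exists p'; split.
  - move=> y; have [yA|/p'out-> //] := boolP (y \in A).
    by have [->|yx] := eqVneq y x; [rewrite p'x | case: (p'A y yx yA) => ->].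
  - move=> y z yA zA; have [->|yx] := eqVneq y x; have [->|zx] := eqVneq z x => //.
    + by case: (p'A z zx zA) => -> ?; rewrite p'x; lia.
    + by case: (p'A y yx yA) => -> ?; rewrite p'x; lia.
    case: (p'A z zx zA) => -> _; case: (p'A y yx yA) => -> _ [].
    by apply: pinj; rewrite in_setD1 ?yx ?zx.
  move=> y yA; have [->|yx] := eqVneq y x.
    apply: (lt_le_trans xlt); rewrite le_eqVlt; apply/orP; left; apply/eqP.
    apply: eq_bigl => z; rewrite p'x; have [zA|/p'out-> //] := boolP (z \in A).
    by have [->|zx] := eqVneq z x; [rewrite p'x | case: (p'A z zx zA) => ->; lia].
  have yA' : y \in A :\ x by rewrite in_setD1 yx.
  apply: (lt_le_trans (pP y yA')); rewrite big_mkcond [leRHS]big_mkcond /=.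
  apply: ler_sum => z _; case: (p'A y yx yA) => -> py.
  case: ltnP => [zy|_]; last by case: ifP.
  suff -> : (p' z < (p y).+1)%N by [].
  have [zA|/p'out-> //] := boolP (z \in A).
  by have [->|zx] := eqVneq z x; [rewrite p'x; lia | case: (p'A z zx zA) => ->; lia].
have [|p [p0 pinj pP]] := burn _ [set~ q] erefl; first by rewrite in_setC1 eqxx.
have pq : p q = 0%N by have := p0 q; rewrite in_setC1 eqxx; lia.
have ppos x : x != q -> (0 < p x)%N by move=> xq; rewrite p0 in_setC1.
exists p, f; split.
  move=> x y; have [->|xq] := eqVneq x q; have [->|yq] := eqVneq y q => //.
  - by rewrite pq => h; have := ppos y yq; lia.
  - by rewrite pq => h; have := ppos x xq; lia.
  by apply: pinj; rewrite in_setC1.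
move=> w; rewrite /orientation_divisor.
have [->|wq] := eqVneq w q; last first.
  by have := pP w; rewrite in_setC1 wq /D' => /(_ isT); lia.
(* At [q] the orientation divisor is [-1], so the bound says that [D'] is negative there; otherwise
   [D'] would be effective. *)
rewrite big1 => [|y]; last by rewrite pq.
suff : ~ 0 <= D q - lap m f q by lia.
move=> Dq; apply: noneff; exists D'; split; last by apply/lin_equivP => //; exists f.
by move=> y; have [->//|/fP] := eqVneq y q.
Qed.

(** Every edge is counted at exactly one of its ends, since injectivity allows ties only on the
    diagonal and there are no loops. *)
Lemma deg_orientation p : injective p -> deg (orientation_divisor p) = genus m - 1.
Proof.
move=> p_inj; rewrite /deg /orientation_divisor sumrB.
have -> : \sum_(x : V) (1 : int) = #|V|%:Z by rewrite sumr_const natz.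
pose S := (\sum_x \sum_(y | (p y < p x)%N) m x y)%N.
have -> : \sum_x \sum_(y | (p y < p x)%N) (m x y)%:Z = S%:Z.
  rewrite /S -natz natr_sum; apply: eq_bigr => x _; rewrite natr_sum.
  by apply: eq_bigr => y _; rewrite natz.
suff : (\sum_x \sum_y m x y = S * 2)%N.
  rewrite /genus /nedges => ->; rewrite mulnK //; ring.
have -> : (S * 2 = S + \sum_x \sum_(y | (p x < p y)%N) m x y)%N.
  rewrite muln2 -addnn; congr addn; rewrite /S; under eq_bigr do rewrite big_mkcond.
  rewrite exchange_big; apply: eq_bigr => x _ /=; rewrite [RHS]big_mkcond.
  by apply: eq_bigr => y _; rewrite m_sym.
rewrite /S -big_split; apply: eq_bigr => x _ /=.
rewrite [X in (X + _)%N]big_mkcond [X in (_ + X)%N]big_mkcond -big_split.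
apply: eq_bigr => y _ /=.
case: ltngtP => [_|_|/p_inj ->] /=; rewrite ?addn0 ?add0n //.
Qed.

(** Among the maxima of [f] take the vertex [x] with least [p]. All vertices before [x] have a
    smaller [f], so [x] loses a chip along each edge to them and ends in debt. *)
Lemma orientation_noneff p : #|V| != 0%N -> injective p ->
  ~ linsys_nonempty m (orientation_divisor p).
Proof.
rewrite -lt0n => /card_gt0P[q _] p_inj [E [E0 /lin_equivP[]// f Ef]].
case: (arg_maxP f (P := predT) (i0 := q)) => // z _ zmax'.
have zmax t : f t <= f z by apply: zmax'.
case: (arg_minnP p (P := fun w => f w == f z) (i0 := z)) => // x /eqP fx xmin.
have := E0 x; rewrite Ef /orientation_divisor.
suff : \sum_(y | (p y < p x)%N) (m x y)%:Z <= lap m f x by lia.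
rewrite big_mkcond; apply: ler_sum => y _; case: ifP => [lt_yx|_].
  have : f y != f z by apply: contraTneq lt_yx => e; rewrite -leqNgt xmin ?e.
  by have := zmax y; rewrite -fx; nia.
by have := zmax y; rewrite -fx; nia.
Qed.

Lemma linsys_large_deg D : #|V| != 0%N -> genus m <= deg D -> linsys_nonempty m D.
Proof.
move=> V0 gD; apply: NNPP => /nonspecial_dominates/(_ V0)[p [f [p_inj le_D]]].
suff : deg D <= genus m - 1 by lia.
rewrite -(deg_orientation p_inj) -(deg_lap m_graph D f).
by apply: ler_sum => w _; apply: le_D.
Qed.

End RiemannInequality.

(** * The rank and its values in small and large degree *)

Section Rank.
Variables (V : finType) (m : V -> V -> nat).
Hypotheses (m_graph : is_graph m) (V0 : #|V| != 0%N).
Implicit Types (D E : divisor V).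

Let eff_deg (n : nat) : exists E : divisor V, effective E /\ deg E = n%:Z.
Proof.
have /card_gt0P[q _] : (0 < #|V|)%N by rewrite lt0n.
exists (dscale n%:Z (chip q)); rewrite deg_scale deg_chip mulr1.
by split=> // w; apply: mulr_ge0.
Qed.

Lemma rank_ge_linsys D n : rank_ge m D n -> linsys_nonempty m D.
Proof.
have [E [E0 degE]] := eff_deg n => /(_ E E0 degE) h.
apply: linsys_equiv (linsys_add m_graph E0 h) => //; apply: lin_equiv_ext => // w.
by rewrite /dadd /dsub subrK.
Qed.

Lemma rank_ge_le_deg D n : rank_ge m D n -> n%:Z <= deg D.
Proof.
have [E [E0 degE]] := eff_deg n => /(_ E E0 degE) /(linsys_deg m_graph).
by rewrite deg_sub degE subr_ge0.
Qed.

Lemma rank_ge_leq D n n' : (n <= n')%N -> rank_ge m D n' -> rank_ge m D n.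
Proof.
move=> le_n h E E0 degE; have [F [F0 degF]] := eff_deg (n' - n).
have EF0 : effective (dadd E F) by move=> w; apply: addr_ge0.
have := h _ EF0; rewrite deg_add degE degF => /(_ ltac:(lia)) {}h.
apply: linsys_equiv (linsys_add m_graph F0 h) => //; apply: lin_equiv_ext => // w.
by rewrite /dadd /dsub; ring.
Qed.

Lemma linsys_rank_ge0 D : linsys_nonempty m D -> rank_ge m D 0.
Proof.
move=> hD E E0 degE; apply: linsys_equiv hD => //; apply: lin_equiv_ext => // w.
move/eqP: degE; rewrite psumr_eq0 // => /allP/(_ w (mem_index_enum w))/eqP e.
by rewrite /dsub e subr0.
Qed.

(** This justifies the [epsilon] in [rank]: the [n] with [rank_ge m D n] are bounded by the degree,
    so a largest one exists when the linear system is nonempty. *)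
Lemma rankP D : rank_spec m D (rank m D).
Proof.
apply: epsilon_spec; have [hD|] := classic (linsys_nonempty m D); last by exists (-1); left.
have [|| r [[n [-> hn]] rmax]] :=
  @int_has_max (fun t => exists n : nat, t = n%:Z /\ rank_ge m D n) (deg D).
- by move=> _ [n [-> /rank_ge_le_deg]].
- by exists 0, 0%N; split=> //; apply: linsys_rank_ge0.
exists n%:Z; right; split=> //; split=> //; split=> // n' hn'.
by apply: rmax; exists n'.
Qed.

Lemma rank_geP D n : rank_ge m D n <-> n%:Z <= rank m D.
Proof.
split=> [h|].
  case: (rankP D) => [[_ []]|[_ [_ [_]]]]; last exact.
  exact: rank_ge_linsys h.
by case: (rankP D) => [[-> _]|[_ [r0 [+ _]]] h]; [lia | apply: rank_ge_leq; lia].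
Qed.

Lemma rank_gem1 D : -1 <= rank m D.
Proof. by case: (rankP D) => [[-> _]|[_ [? _]]]; lia. Qed.

Lemma linsys_rank D : linsys_nonempty m D <-> 0 <= rank m D.
Proof.
split=> [h|]; first by apply/(rank_geP D 0); apply: linsys_rank_ge0.
by move/(rank_geP D 0)/rank_ge_linsys.
Qed.

Lemma rank_mono D E : (forall n, rank_ge m D n -> rank_ge m E n) -> rank m D <= rank m E.
Proof.
move=> h; have := rank_gem1 E; case: (leP 0 (rank m D)) => [r0 _|]; last by lia.
have e : rank m D = `|rank m D|%N%:Z by lia.
by rewrite e; apply/rank_geP/h/rank_geP; lia.
Qed.

Lemma rank_equiv D E : lin_equiv m D E -> rank m D = rank m E.
Proof.
suff le A B : lin_equiv m A B -> rank m A <= rank m B.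
  move=> h; apply/eqP; rewrite eq_le !le //; exact: lin_equiv_sym h.
move=> AB; apply: rank_mono => n h F F0 degF.
apply: linsys_equiv (h F F0 degF) => //.
by apply: lin_equiv_sub => //; apply: lin_equiv_refl.
Qed.

Lemma rank_ext D E : (forall w, D w = E w) -> rank m D = rank m E.
Proof. by move=> h; apply: rank_equiv; apply: lin_equiv_ext. Qed.

Lemma rank_deg_neg D : deg D < 0 -> rank m D = -1.
Proof.
move=> D0; have := rank_gem1 D; suff : ~ 0 <= rank m D by lia.
by move=> /linsys_rank/(linsys_deg m_graph); lia.
Qed.

(** For the upper bound, subtract an orientation divisor from [D] and take an effective
    representative [E] of the difference: if the rank reached [deg E], the noneffective orientation
    divisor, equivalent to [D - E], would have a nonempty linear system. The lower bound is
    Riemann's inequality in degree [genus m]. *)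
Lemma rank_large_deg D : 1 <= genus m -> genus m * 2 - 1 <= deg D ->
  rank m D = deg D - genus m.
Proof.
move=> g1 gD; apply/eqP; rewrite eq_le; apply/andP; split.
  pose p (x : V) : nat := enum_rank x.
  have p_inj : injective p by move=> x y /val_inj/enum_rank_inj.
  have degp := deg_orientation m_graph p_inj.
  have [E [E0 hE]] : linsys_nonempty m (dsub D (orientation_divisor m p)).
    by apply: linsys_large_deg; rewrite // deg_sub degp; lia.
  have degE : deg E = deg D - genus m + 1.
    by rewrite -(lin_equiv_deg m_graph hE) deg_sub degp; ring.
  rewrite leNgt; apply/negP => lt_r; apply: (orientation_noneff m_graph V0 p_inj).
  have /rank_geP/(_ E E0) h : `|deg E|%N%:Z <= rank m D by lia.
  apply: linsys_equiv (h ltac:(lia)) => //.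
  apply: (lin_equiv_trans m_graph (lin_equiv_sub m_graph (lin_equiv_refl m_graph D)
    (lin_equiv_sym m_graph hE))).
  by apply: lin_equiv_ext => // w; rewrite /dsub; ring.
have e : deg D - genus m = `|deg D - genus m|%N%:Z by lia.
rewrite e; apply/rank_geP => E E0 degE; apply: linsys_large_deg => //.
by rewrite deg_sub degE; lia.
Qed.

(** Positive rank would make [D] equivalent to each single chip, against [chip_inj]. *)
Lemma rank_deg1 D (x y : V) : bridgeless m -> x != y -> deg D = 1 -> rank m D <= 0.
Proof.
move=> m_bridgeless xy degD; rewrite leNgt; apply/negP => r1.
have D_chip z : lin_equiv m D (chip z).
  have /rank_geP/(_ _ (@chip_eff V z)) h : (1%N)%:Z <= rank m D by lia.
  have /(linsys_deg0 m_graph) := h (deg_chip z).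
  rewrite deg_sub deg_chip degD subrr => /(_ erefl) h0.
  have := lin_equiv_lin m_graph 1 h0 (lin_equiv_refl m_graph (chip z)).
  by move=> h1; apply: (lin_equiv_trans m_graph _ (lin_equiv_trans m_graph h1 _));
    apply: lin_equiv_ext => // w; rewrite /dadd /dscale /dsub /dzero; ring.
move/eqP: xy; apply; apply: (chip_inj m_graph m_bridgeless).
exact: lin_equiv_trans (lin_equiv_sym m_graph (D_chip x)) (D_chip y).
Qed.

End Rank.

(** * The transmission permutation of an abstract rank function *)

Lemma unit_jump (G : int -> int) (lo : int) (n : nat) :
  (forall x : int, G (x - 1) <= G x) -> (forall x : int, x <= lo -> G x = 0) ->
  (forall x : int, lo + n%:Z <= x -> G x = 1) ->
  exists a, forall x, G x - G (x - 1) = ((a == x) : nat)%:Z.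
Proof.
move=> Gmono G0; elim: n => [|n IHn] G1.
  by have := G0 lo (lexx _); rewrite G1 ?addr0.
have mono (x y : int) : x <= y -> G x <= G y.
  have [j] : exists j : nat, y - x <= j%:Z by exists `|y - x|%N; lia.
  elim: j y => [|j IHj] y le_j le_xy; first by have -> : y = x by lia.
  have [->//|ne] := eqVneq y x.
  by apply: le_trans (IHj (y - 1) _ _) (Gmono y); lia.
have G01 (x : int) : 0 <= G x <= 1.
  have := mono (Num.min x lo) x ltac:(lia); rewrite G0; last by lia.
  by have := mono x (Num.max x (lo + n.+1%:Z)) ltac:(lia); rewrite (G1 (Num.max _ _)); lia.
have [|] : G (lo + n%:Z) = 1 \/ G (lo + n%:Z) = 0 by have := G01 (lo + n%:Z); lia.
  move=> Gn; apply: IHn => x; rewrite le_eqVlt => /orP[/eqP <- //|lt_x].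
  by apply: G1; lia.
move=> Gn; exists (lo + n.+1%:Z) => x.
have below (y : int) : y <= lo + n%:Z -> G y = 0.
  by move=> /mono; rewrite Gn; have := G01 y; lia.
case: eqP => [<-|/eqP ne_x].
  by rewrite G1 // below //; lia.
have [le_x|lt_x] := leP x (lo + n%:Z); first by rewrite !below //; lia.
by rewrite !G1 //; lia.
Qed.

Section Transmission.
Variables (F : int -> int -> int) (d : int).

Definition DeltaF a b := F a b - F (a - 1) b - F a (b + 1) + F (a - 1) (b + 1).

Hypothesis F_neg : forall a b : int, d + a - b < 0 -> F a b = -1.
Hypothesis F_large : forall a b : int, 3 <= d + a - b -> F a b = d + a - b - 2.

Lemma transmission_exists : (forall a b, 0 <= DeltaF a b) ->
  exists tau, bijective tau /\ forall a b, ((tau b == a) : nat)%:Z = DeltaF a b.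
Proof.
move=> F_submod.
have row b : exists a, forall x, DeltaF x b = ((a == x) : nat)%:Z.
  (* Up to [b - d - 1] both degrees are negative and the difference is 0; five steps later both are
     at least 3 and it is 1. *)
  have [|||a aP] := @unit_jump (fun x => F x b - F x (b + 1)) (b - d - 1) 5.
  - by move=> x; have := F_submod x b; rewrite /DeltaF; lia.
  - by move=> x ?; rewrite !F_neg //; lia.
  - by move=> x ?; rewrite !F_large //; lia.
  by exists a => x; rewrite -aP /DeltaF; lia.
have col a : exists b, forall y, DeltaF a y = ((b == y) : nat)%:Z.
  (* The substitution [y = - b] makes the degree grow with [y], as [unit_jump] requires. *)
  have [|||b bP] := @unit_jump (fun y => F a (- y) - F (a - 1) (- y)) (- (d + a) - 1) 5.
  - move=> y; have := F_submod a (- y).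
    by rewrite /DeltaF (_ : - y + 1 = - (y - 1)); [lia | ring].
  - by move=> y ?; rewrite !F_neg //; lia.
  - by move=> y ?; rewrite !F_large //; lia.
  exists (- b) => y; rewrite (_ : (- b == y) = (b == - y)); last by apply/eqP/eqP; lia.
  by rewrite -bP /DeltaF opprK (_ : - (- y - 1) = y + 1); [lia | ring].
pose tau b := proj1_sig (constructive_indefinite_description _ (row b)).
have tauP b x : DeltaF x b = ((tau b == x) : nat)%:Z.
  by rewrite /tau; case: constructive_indefinite_description.
pose inv a := proj1_sig (constructive_indefinite_description _ (col a)).
have invP a y : DeltaF a y = ((inv a == y) : nat)%:Z.
  by rewrite /inv; case: constructive_indefinite_description.
exists tau; split; last by move=> a b; rewrite tauP.
exists inv => [b|a].
  by apply/eqP; have := invP (tau b) b; rewrite tauP eqxx; case: eqP.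
by apply/eqP; have := tauP (inv a) a; rewrite invP eqxx; case: eqP.
Qed.

Variable tau : int -> int.
Hypothesis tauP : forall a b : int, ((tau b == a) : nat)%:Z = DeltaF a b.

(** Outside this range the four degrees in [DeltaF] are all negative or all at least 3, where [F] is
    affine and its mixed difference vanishes. *)
Lemma transmission_near b : 0 <= d + tau b - b <= 4.
Proof.
have := tauP (tau b) b; rewrite eqxx /DeltaF.
have [lt0|ge0] := ltP (d + tau b - b) 0; first by rewrite !F_neg //; lia.
have [//|gt4] := leP (d + tau b - b) 4.
by rewrite !F_large //; lia.
Qed.

(** Sum [DeltaF] along the row of [b], starting at [b - d - 1], where both values of [F] are
    [-1]. *)
Lemma transmission_row a b : F a b - F a (b + 1) = ((tau b <= a)%R : nat)%:Z.
Proof.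
have near := transmission_near b.
have step (n : nat) : let x := b - d - 1 + n%:Z in
    F x b - F x (b + 1) = ((tau b <= x)%R : nat)%:Z.
  elim: n => [|n IHn] /=; first by rewrite !F_neg; lia.
  have := tauP (b - d - 1 + n.+1%:Z) b; rewrite /DeltaF.
  have -> : b - d - 1 + n.+1%:Z - 1 = b - d - 1 + n%:Z by lia.
  by move: IHn => /=; lia.
have [lt_a|le_a] := ltP a (b - d); first by rewrite !F_neg; lia.
have := step `|(a - (b - d - 1))%R|%N.
by have -> /= : b - d - 1 + `|(a - (b - d - 1))%R|%N%:Z = a by lia.
Qed.

(* Shifted so that the diagonal corresponds to divisors of degree 2. *)
Definition centered b := tau b + (d - 2).

Lemma centered_near b : - 2 <= centered b - b /\ centered b - b <= 2.
Proof. by have := transmission_near b; rewrite /centered; lia. Qed.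

(** The pair [(c - d + 1, c)] has degree 1; raising [c] twice reaches degree [-1], where [F] is
    [-1]. *)
Lemma descentsE c : (descents centered c)%:Z = F (c - d + 1) c + 1.
Proof.
have h0 := transmission_row (c - d + 1) c.
have h1 := transmission_row (c - d + 1) (c + 1).
have h2 := @F_neg (c - d + 1) (c + 1 + 1) ltac:(lia).
by rewrite /descents /centered; lia.
Qed.

(** Lowering [c] twice reaches degree 3, where [F] is 1. *)
Lemma ascentsE c : (ascents centered c)%:Z = F (c - d + 1) c + 1.
Proof.
have h0 := transmission_row (c - d + 1) (c - 1).
have h1 := transmission_row (c - d + 1) (c - 2).
have h2 := @F_large (c - d + 1) (c - 2) ltac:(lia).
rewrite (_ : c - 1 + 1 = c) in h0; last by ring.
rewrite (_ : c - 2 + 1 = c - 1) in h1; last by ring.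
by rewrite /ascents /centered; lia.
Qed.

Hypothesis F_deg1 : forall a b : int, d + a - b = 1 -> F a b <= 0.
Hypothesis F_rigid : forall a b : int, d + a - b = 0 -> F a b = 0 -> F (a + 1) (b - 1) = 0.

Lemma centered_descents_le1 c : (descents centered c <= 1)%N.
Proof. by have := descentsE c; have := @F_deg1 (c - d + 1) c ltac:(lia); lia. Qed.

Lemma centered_ascents_descents c : ascents centered c = descents centered c.
Proof. by have := descentsE c; have := ascentsE c; lia. Qed.

(** The first equation makes the divisor at [(x - d, x)] trivial, so rigidity gives rank 0 in degree
    2. This pushes [centered (x - 1)] up to at least [x]; with [centered (x - 2) = x] the cut [x]
    has two ascents. *)
Lemma centered_rigid x : ~ (centered x = x - 2 /\ centered (x - 2) = x).
Proof.
rewrite /centered => -[e e'].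
have tx : tau x = x - d by lia.
have F0 : F (x - d) x = 0.
  have := tauP (x - d) x; rewrite tx eqxx /DeltaF.
  have h1 := @F_neg (x - d - 1) x ltac:(lia).
  have h2 := @F_neg (x - d) (x + 1) ltac:(lia).
  have h3 := @F_neg (x - d - 1) (x + 1) ltac:(lia).
  by lia.
have F2 := @F_rigid (x - d) x ltac:(lia) F0.
(* From degree 2 down to degree [-1] the rank drops by 1 in all, and the position [x] already
   accounts for that drop. *)
have h0 := transmission_row (x - d + 1) (x - 1).
have h1 := transmission_row (x - d + 1) x.
have h2 := transmission_row (x - d + 1) (x + 1).
have h3 := @F_neg (x - d + 1) (x + 1 + 1) ltac:(lia).
rewrite (_ : x - 1 + 1 = x) in h0; last by ring.
have := centered_descents_le1 x; rewrite -centered_ascents_descents /ascents /centered.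
by lia.
Qed.

Variable k : nat.
Hypothesis F_periodic : forall a b : int, F (a + k%:Z) (b + k%:Z) = F a b.

Lemma centered_periodic x : centered (x + k%:Z) = centered x + k%:Z.
Proof.
suff : tau (x + k%:Z) = tau x + k%:Z by rewrite /centered => ->; ring.
have := tauP (tau x + k%:Z) (x + k%:Z); rewrite /DeltaF.
rewrite (_ : tau x + k%:Z - 1 = tau x - 1 + k%:Z); last by ring.
rewrite (_ : x + k%:Z + 1 = x + 1 + k%:Z); last by ring.
by rewrite !F_periodic -/(DeltaF _ _) -tauP eqxx; case: eqP.
Qed.

Lemma transmission_inv_k_le2 : bijective tau ->
  inv_k_le tau k 2 <-> forall c1 c2 c3,
    0 <= F (c1 - d + 1) c1 -> 0 <= F (c2 - d + 1) c2 -> 0 <= F (c3 - d + 1) c3 ->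
    [\/ (k%:Z %| c1 - c2)%Z, (k%:Z %| c1 - c3)%Z | (k%:Z %| c2 - c3)%Z].
Proof.
move=> tau_bij.
have inj : injective centered by move=> x y /addIr; apply: bij_inj.
have invE a b : inversion tau a b <-> inversion centered a b.
  by rewrite /inversion /centered; lia.
have leE : inv_k_le tau k 2 <-> inv_k_le centered k 2.
  split=> -[l [size_l lP]]; exists l; split=> // a b /invE/lP[q ql [/invE qi qe]];
    by exists q.
have cutE c : descents centered c = 1%N <-> 0 <= F (c - d + 1) c.
  by have := descentsE c; have := centered_descents_le1 c; lia.
rewrite leE inv_k_le2 //.
- by split=> H c1 c2 c3 /cutE h1 /cutE h2 /cutE h3; apply: H.
- exact: centered_near.
- exact: centered_descents_le1.
- exact: centered_ascents_descents.
- exact: centered_rigid.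
- exact: centered_periodic.
Qed.

End Transmission.

(** * Transmission and recurrence on a rigidly marked graph of genus 2 *)

Section Genus2.
Variables (V : finType) (m : V -> V -> nat) (u v : V) (k : nat).
Hypotheses (m_graph : is_graph m) (m_bridgeless : bridgeless m) (m_genus : genus m = 2).
Hypotheses (uv : u != v) (m_rigid : rigidly_marked m u v) (m_torsion : torsion_order m u v k).
Implicit Types (D : divisor V).

Let V0 : #|V| != 0%N. Proof. by rewrite -lt0n; apply/card_gt0P; exists u. Qed.

Lemma deg_twist D a b : deg (twist u v D a b) = deg D + a + b.
Proof. by rewrite !deg_add !deg_scale !deg_chip !mulr1. Qed.

Lemma twist_periodic D a b (j : int) :
  lin_equiv m (twist u v D (a + j * k%:Z) (- (b + j * k%:Z))) (twist u v D a (- b)).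
Proof.
have [_ [kuv _]] := m_torsion.
have := lin_equiv_lin m_graph j kuv
  (lin_equiv_refl m_graph (twist u v D a (- (b + j * k%:Z)))).
by move=> h; apply: (lin_equiv_trans m_graph _ (lin_equiv_trans m_graph h _));
  apply: lin_equiv_ext => // w; rewrite /twist /dadd /dscale; ring.
Qed.

Definition rank_twist D (a b : int) : int := rank m (twist u v D a (- b)).

Lemma DeltaF_rank_twist D a b :
  DeltaF (rank_twist D) a b = Delta m u v (twist u v D a (- b)).
Proof.
rewrite /DeltaF /Delta /rank_twist; congr (_ - _ - _ + _); apply: rank_ext => // w;
  by rewrite /twist /dadd /dsub /dscale; ring.
Qed.

Lemma rank_twist_neg D a b : deg D + a - b < 0 -> rank_twist D a b = -1.
Proof. by move=> h; apply: rank_deg_neg; rewrite ?deg_twist. Qed.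

Lemma rank_twist_large D a b : 3 <= deg D + a - b -> rank_twist D a b = deg D + a - b - 2.
Proof.
by move=> h; rewrite /rank_twist rank_large_deg // m_genus ?deg_twist //; lia.
Qed.

Lemma rank_twist_deg1 D a b : deg D + a - b = 1 -> rank_twist D a b <= 0.
Proof. by move=> h; apply: (@rank_deg1 _ _ _ _ _ u v); rewrite ?deg_twist. Qed.

(** In degree 0, rank 0 means the trivial class, so the new twist is equivalent to [u + v]. *)
Lemma rank_twist_rigid D a b : deg D + a - b = 0 -> rank_twist D a b = 0 ->
  rank_twist D (a + 1) (b - 1) = 0.
Proof.
move=> deg0 rank0; have [_ <-] := m_rigid; apply: rank_equiv => //.
have hD : lin_equiv m (twist u v D a (- b)) (@dzero V).
  apply: linsys_deg0; rewrite ?deg_twist //; apply/linsys_rank => //.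
  by rewrite -/(rank_twist D a b) rank0.
have h := lin_equiv_lin m_graph 1 hD (lin_equiv_refl m_graph (dadd (chip u) (chip v))).
apply: (lin_equiv_trans m_graph _ (lin_equiv_trans m_graph h _)).
  by apply: lin_equiv_ext => // w; rewrite /twist /dadd /dscale; ring.
by apply: lin_equiv_ext => // w; rewrite /dadd /dscale /dzero; ring.
Qed.

Lemma rank_twist_periodic D a b : rank_twist D (a + k%:Z) (b + k%:Z) = rank_twist D a b.
Proof.
by apply: rank_equiv => //; have := twist_periodic D a b 1; rewrite mul1r.
Qed.

(** The divisors [A c] have degree 1 and form an orbit under translation by [u - v]; the right side
    says that at most two residues of [c] modulo [k] give a nonempty linear system. *)
Lemma inv_k_le_effective D tau : is_transmission_perm m u v D tau ->
  inv_k_le tau k 2 <-> forall c1 c2 c3 : int,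
    let A c := twist u v D (c - deg D + 1) (- c) in
    linsys_nonempty m (A c1) -> linsys_nonempty m (A c2) -> linsys_nonempty m (A c3) ->
    [\/ (k%:Z %| c1 - c2)%Z, (k%:Z %| c1 - c3)%Z | (k%:Z %| c2 - c3)%Z].
Proof.
case=> tau_bij tauP.
rewrite (@transmission_inv_k_le2 (rank_twist D) (deg D)) //.
- have E c := linsys_rank m_graph V0 (twist u v D (c - deg D + 1) (- c)).
  by split=> H c1 c2 c3 /= /E h1 /E h2 /E h3; apply: H.
- exact: rank_twist_neg.
- exact: rank_twist_large.
- by move=> a b; rewrite tauP DeltaF_rank_twist.
- exact: rank_twist_deg1.
- exact: rank_twist_rigid.
- exact: rank_twist_periodic.
Qed.

Lemma transmission_perm_exists D : exists tau, is_transmission_perm m u v D tau.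
Proof.
have [||a b|tau [tau_bij tauP]] := @transmission_exists (rank_twist D) (deg D).
- exact: rank_twist_neg.
- exact: rank_twist_large.
- by rewrite DeltaF_rank_twist; case: m_rigid => + _; apply.
by exists tau; split=> // a b; rewrite tauP DeltaF_rank_twist.
Qed.

Lemma scale_sub_zero (j : nat) :
  lin_equiv m (dscale j%:Z (dsub (chip u) (chip v))) (@dzero V) <->
  lin_equiv m (dscale j%:Z (chip u)) (dscale j%:Z (chip v)).
Proof.
split=> h.
  have := lin_equiv_lin m_graph 1 h (lin_equiv_refl m_graph (dscale j%:Z (chip v))).
  by move=> h'; apply: (lin_equiv_trans m_graph _ (lin_equiv_trans m_graph h' _));
    apply: lin_equiv_ext => // w; rewrite /dadd /dscale /dsub /dzero; ring.
have := lin_equiv_sub m_graph h (lin_equiv_refl m_graph (dscale j%:Z (chip v))).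
by move=> h'; apply: (lin_equiv_trans m_graph _ (lin_equiv_trans m_graph h' _));
  apply: lin_equiv_ext => // w; rewrite /dscale /dsub /dzero; ring.
Qed.

Lemma class_order_torsion k' : class_order m (dsub (chip u) (chip v)) k' <-> k' = k.
Proof.
have [k0 [kuv kmin]] := m_torsion; split=> [[k'0 [/scale_sub_zero k'uv k'min]]|->].
  case: (ltngtP k' k) => // lt_k.
    by have := kmin k'; rewrite k'0 lt_k => /(_ isT).
  by have := k'min k; rewrite k0 lt_k => /(_ isT) []; apply/scale_sub_zero.
split=> //; split; first by apply/scale_sub_zero.
by move=> j /kmin nj /scale_sub_zero.
Qed.

Lemma dvdz_small (i j : nat) : (i < k)%N -> (j < k)%N -> (k%:Z %| i%:Z - j%:Z)%Z -> i = j.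
Proof.
move=> ik jk; rewrite -eqz_mod_dvd !modz_nat eqz_nat !modn_small //.
by move/eqP.
Qed.

(** For the divisor [w] itself, the cut 0 is effective and incongruent to [n1] and [n2], so these
    two must share a class. *)
Lemma general_transmission_non_recurrent :
  k_general_transmission m u v k -> non_recurrent m (dsub (chip u) (chip v)).
Proof.
move=> [_ [_ gen]] k' /class_order_torsion -> w n1 n2 /andP[n1_0 n1k] /andP[n2_0 n2k] h1 h2.
have [tau [tau_perm]] := gen (chip w).
rewrite m_genus => /(inv_k_le_effective tau_perm) /= H.
have cut (n : nat) : linsys_nonempty m
    (dadd (dscale n%:Z (dsub (chip u) (chip v))) (chip w)) ->
    linsys_nonempty m (twist u v (chip w) (n%:Z - deg (chip w) + 1) (- n%:Z)).
  apply: linsys_equiv => //; apply: lin_equiv_ext => // x.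
  by rewrite deg_chip /twist /dadd /dsub /dscale; ring.
have h0 : linsys_nonempty m (dadd (dscale 0%N%:Z (dsub (chip u) (chip v))) (chip w)).
  exists (chip w); split; first exact: chip_eff.
  by apply: lin_equiv_ext => // x; rewrite /dadd /dscale mul0r add0r.
have k0 : (0 < k)%N by apply: leq_ltn_trans n1k.
have [/dvdz_small|/dvdz_small|/dvdz_small] := H _ _ _ (cut _ h0) (cut _ h1) (cut _ h2).
- by move=> /(_ k0 n1k) e; rewrite -e in n1_0.
- by move=> /(_ k0 n2k) e; rewrite -e in n2_0.
exact.
Qed.

(** Given three effective cuts, take the vertex [w] representing the first as base point; the other
    two become multiples of [u - v] added to [w]. *)
Lemma non_recurrent_general_transmission :
  non_recurrent m (dsub (chip u) (chip v)) -> k_general_transmission m u v k.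
Proof.
move=> nonrec; have [k0 [kuv _]] := m_torsion; have [submod _] := m_rigid.
split=> //; split=> // D; have [tau tau_perm] := transmission_perm_exists D.
exists tau; split=> //; rewrite m_genus; apply/(inv_k_le_effective tau_perm).
move=> c1 c2 c3; set A := fun c => _; cbv zeta => h1 h2 h3.
have [w hw] : exists w, lin_equiv m (A c1) (chip w).
  by apply: linsys_deg1 h1 _ => //; rewrite /A deg_twist; ring.
(* Here [n] is the residue of [c - c1] modulo [k]; residue 0 means the class of [c1], and
   non-recurrence compares two nonzero residues. *)
have step c : linsys_nonempty m (A c) -> exists2 n : nat, (n < k)%N &
    (k%:Z %| c - c1 - n%:Z)%Z /\
    linsys_nonempty m (dadd (dscale n%:Z (dsub (chip u) (chip v))) (chip w)).
  move=> hc; pose n := `|((c - c1) %% k%:Z)%Z|%N.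
  have nE : n%:Z = ((c - c1) %% k%:Z)%Z by rewrite /n gez0_abs // modz_ge0 //; lia.
  exists n; first by have := ltz_pmod (c - c1) (d := k%:Z); lia.
  have dE := divz_eq (c - c1) k%:Z; set j := ((c - c1) %/ k%:Z)%Z in dE.
  rewrite -nE in dE; split; first by rewrite dE addrK dvdz_mull.
  have := twist_periodic D (c1 + n%:Z - deg D + 1) (c1 + n%:Z) j.
  have -> : c1 + n%:Z - deg D + 1 + j * k%:Z = c - deg D + 1 by lia.
  have -> : c1 + n%:Z + j * k%:Z = c by lia.
  move=> hcn; apply: linsys_equiv hc => //; apply: (lin_equiv_trans m_graph hcn).
  have := lin_equiv_lin m_graph n%:Z (lin_equiv_refl m_graph (dsub (chip u) (chip v))) hw.
  apply: lin_equiv_trans => //; apply: lin_equiv_ext => // x.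
  by rewrite /A /twist /dadd /dsub /dscale; ring.
have [n2 n2k [d2 l2]] := step c2 h2; have [n3 n3k [d3 l3]] := step c3 h3.
have [n2_0|n2_0] := posnP n2.
  by constructor 1; move: d2; rewrite n2_0 subr0 -opprB rpredN.
have [n3_0|n3_0] := posnP n3.
  by constructor 2; move: d3; rewrite n3_0 subr0 -opprB rpredN.
have ord : class_order m (dsub (chip u) (chip v)) k by apply/class_order_torsion.
have e := nonrec k ord w n2 n3 _ _ l2 l3; constructor 3.
rewrite -e in d3; rewrite ?n2_0 ?n3_0 //.
have -> : c2 - c3 = (c2 - c1 - n2%:Z) - (c3 - c1 - n2%:Z) by ring.
exact: rpredB.
Qed.

End Genus2.

Theorem mainTheorem5 (V : finType) (m : V -> V -> nat) (u v : V) (k : nat) :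
  is_graph m -> bridgeless m -> genus m = 2 -> u != v ->
  rigidly_marked m u v -> torsion_order m u v k ->
  (k_general_transmission m u v k <-> non_recurrent m (dsub (chip u) (chip v))).
Proof.
move=> m_graph m_bridgeless m_genus uv m_rigid m_torsion; split.
  exact: general_transmission_non_recurrent.
exact: non_recurrent_general_transmission.
Qed.
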